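(* The following identity holds (as formal power series in $t$ with coefficients in $\mathbb{C}_\infty$, equivalently as functions of $t\in\mathbb{C}_\infty$ with $|t|<q$): $$L(\chi_t,1)=-\frac{\widetilde{\pi}}{(t-\theta)\,s_{\mathrm{Car}}(t)},$$ where $L(\chi_t,1)=\sum_{a\in A^+}\chi_t(a)a^{-1}$.
   Context: Let $q=p^e$ be a power of a prime $p$ ($e>0$), $A=\mathbb{F}_q[\theta]$ with $\theta$ an indeterminate, $K=\mathbb{F}_q(\theta)$, with absolute value $|a|=q^{\deg_\theta a}$, so $|\theta|=q$. Let $K_\infty=\mathbb{F}_q((1/\theta))$ be the completion of $K$, and $\mathbb{C}_\infty$ the completion of an algebraic closure of $K_\infty$. $A^+$ is the set of monic polynomials of $A$. For $t$ an indeterminate or an element of $\mathbb{C}_\infty$, $\chi_t(a)=a(t)$ denotes the result of substituting $t$ for $\theta$ in $a\in A$. For an integer $\alpha>0$, $L(\chi_t,\alpha)=\sum_{a\in A^+}\chi_t(a)a^{-\alpha}$, a well-defined element of $K_\infty[[t]]$ which converges for $t\in\mathbb{C}_\infty$ with $\log_q|t|<\alpha$. Carlitz exponential: $e_{\mathrm{Car}}(\eta)=\sum_{n\ge0}\eta^{q^n}/d_n$ for $\eta\in\mathbb{C}_\infty$, where $d_0=1$, $d_i=[i][i-1]^q\cdots[1]^{q^{i-1}}$ and $[i]=\theta^{q^i}-\theta$ for $i>0$. $\widetilde{\pi}$ is a fixed fundamental period of $e_{\mathrm{Car}}$ (a generator of the $A$-module $\ker e_{\mathrm{Car}}$), given,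 for a choice of a $(q-1)$-th root of $-\theta$, by $\widetilde{\pi}=\theta(-\theta)^{1/(q-1)}\prod_{i\ge1}(1-\theta^{1-q^i})^{-1}$. $$s_{\mathrm{Car}}(t)=\sum_{i=0}^\infty e_{\mathrm{Car}}\left(\frac{\widetilde{\pi}}{\theta^{i+1}}\right)t^i=\sum_{n=0}^\infty\frac{\widetilde{\pi}^{q^n}}{d_n(\theta^{q^n}-t)},$$ which converges for $|t|<q$. *)

(* Defs.v *)
(* MathComp / MathComp-Analysis *)
From HB Require Import structures.
From mathcomp Require Import all_boot all_order all_algebra.
From mathcomp Require Import finmap.
From mathcomp Require Import all_classical all_reals all_analysis.
From mathcomp.analysis.showcase Require Import summability.
Set Implicit Arguments.
Unset Strict Implicit.
Unset Printing Implicit Defensive.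
Import Order.TTheory GRing.Theory Num.Theory.
Import numFieldNormedType.Exports.
Local Open Scope classical_set_scope.
Local Open Scope ring_scope.

(* The normed structures of the library force [`|x *+ n| = `|x| *+ n], which
   fails in characteristic p; absolute values are therefore plain functions to
   the reals. *)
Record absolute_value (R : realType) (E : fieldType) (av : E -> R) : Prop :=
  AbsoluteValue {
    av_ge0 : forall x, 0 <= av x;
    av_eq0 : forall x, av x = 0 <-> x = 0;
    avM : forall x y, av (x * y) = av x * av y;
    av_ultra : forall x y, av (x + y) <= Num.max (av x) (av y) }.

Definition av_cvg (R : realType) (E : fieldType) (av : E -> R) (T : Type)
    (D : set_system T) (u : T -> E) (l : E) : Prop :=
  (fun x => av (u x - l)) @ D --> (0 : R).

(* The limit of [u] along [D], and [0] when there is none. *)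
Definition av_lim (R : realType) (E : fieldType) (av : E -> R) (T : Type)
    (D : set_system T) (u : T -> E) : E :=
  xget 0 [set l | av_cvg av D u l].

Definition av_cauchy (R : realType) (E : fieldType) (av : E -> R)
    (u : nat -> E) : Prop :=
  forall eps : R, 0 < eps ->
    exists N, forall m n, (N <= m)%N -> (N <= n)%N -> av (u m - u n) < eps.

Record is_completion (R : realType) (E E' : fieldType) (av : E -> R)
    (av' : E' -> R) (j : {rmorphism E -> E'}) : Prop := IsCompletion {
  completion_av : absolute_value av';
  completion_isom : forall x, av' (j x) = av x;
  completion_dense : forall y (eps : R), 0 < eps -> exists x, av' (y - j x) < eps;
  completion_complete : forall u, av_cauchy av' u ->
    exists l, av_cvg av' \oo u l }.

Definition poly_av (R : realType) (F : finFieldType) (a : {poly F}) : R :=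
  if a == 0 then 0 else #|F|%:R ^+ (size a).-1.

Definition frac_av (R : realType) (F : finFieldType)
    (x : {fraction {poly F}}) : R :=
  poly_av R (frac (repr x)).1 / poly_av R (frac (repr x)).2.

(* With F = F_q, q = #|F| and K = F_q(theta): the completion K_oo of K, an
   algebraic closure of K_oo with the extended absolute value, and the
   completion C_oo of the latter.  These properties determine the tower up to
   isometric isomorphism. *)
Record Cinf_tower (R : realType) (F : finFieldType) := CinfTower {
  Kinf : fieldType;
  Kinf_av : Kinf -> R;
  K_to_Kinf : {rmorphism {fraction {poly F}} -> Kinf};
  Kinf_completion : is_completion (@frac_av R F) Kinf_av K_to_Kinf;
  Kbar : closedFieldType;
  Kbar_av : Kbar -> R;
  Kinf_to_Kbar : {rmorphism Kinf -> Kbar};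
  Kbar_algebraic : forall x, algebraicOver Kinf_to_Kbar x;
  Kbar_avP : absolute_value Kbar_av;
  Kbar_av_ext : forall x, Kbar_av (Kinf_to_Kbar x) = Kinf_av x;
  Cinf : fieldType;
  Cinf_av : Cinf -> R;
  Kbar_to_Cinf : {rmorphism Kbar -> Cinf};
  Cinf_completion : is_completion Kbar_av Cinf_av Kbar_to_Cinf }.

Arguments Cinf_av {R F} c x.

Definition A_to_Cinf (R : realType) (F : finFieldType) (X : Cinf_tower R F)
    (a : {poly F}) : Cinf X :=
  Kbar_to_Cinf X (Kinf_to_Kbar X (K_to_Kinf X (FracField.tofrac a))).

Definition theta (R : realType) (F : finFieldType) (X : Cinf_tower R F) :
  Cinf X := A_to_Cinf X 'X.

(* a(t) for an indeterminate t *)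
Definition chi (R : realType) (F : finFieldType) (X : Cinf_tower R F)
    (a : {poly F}) : {poly Cinf X} :=
  map_poly (fun c : F => A_to_Cinf X c%:P) a.

(* Sum over the infinite set of monic polynomials, unconditionally: limit of
   the finite sums along the directed set of finite sets of polynomials. *)
Definition sum_monic (R : realType) (F : finFieldType) (X : Cinf_tower R F)
    (f : {poly F} -> Cinf X) : Cinf X :=
  av_lim (Cinf_av X) totally
    (fun S : {fset {poly F}} => \sum_(a <- S | a \is monic) f a).

Definition sum_nat (R : realType) (F : finFieldType) (X : Cinf_tower R F)
    (f : nat -> Cinf X) : Cinf X :=
  av_lim (Cinf_av X) \oo (fun N => \sum_(0 <= n < N) f n).

Definition prod_ge1 (R : realType) (F : finFieldType) (X : Cinf_tower R F)
    (f : nat -> Cinf X) : Cinf X :=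
  av_lim (Cinf_av X) \oo (fun N => \prod_(1 <= i < N.+1) f i).

Definition bracket (R : realType) (F : finFieldType) (X : Cinf_tower R F)
    (i : nat) : Cinf X :=
  theta X ^+ (#|F| ^ i) - theta X.

Definition carlitz_d (R : realType) (F : finFieldType) (X : Cinf_tower R F)
    (i : nat) : Cinf X :=
  \prod_(1 <= j < i.+1) bracket X j ^+ (#|F| ^ (i - j)).

Definition e_Car (R : realType) (F : finFieldType) (X : Cinf_tower R F)
    (eta : Cinf X) : Cinf X :=
  sum_nat (fun n => eta ^+ (#|F| ^ n) / carlitz_d X n).

(* The fundamental period attached to a (q-1)-th root [lam] of -theta; the
   exponent 1 - q^i is a negative integer. *)
Definition carlitz_period (R : realType) (F : finFieldType)
    (X : Cinf_tower R F) (lam : Cinf X) : Cinf X :=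
  theta X * lam *
    prod_ge1 (fun i => (1 - theta X ^ (1 - (#|F| ^ i)%N%:Z))^-1).

(* Formal power series over E, as sequences of coefficients *)
Definition fps (E : fieldType) := nat -> E.

Definition fps_of_poly (E : fieldType) (p : {poly E}) : fps E := fun k => p`_k.

Definition fps_mul (E : fieldType) (f g : fps E) : fps E :=
  fun n => \sum_(i < n.+1) f i * g (n - i)%N.

Fixpoint fps_inv_seq (E : fieldType) (f : fps E) (n : nat) : seq E :=
  if n is m.+1 then
    let s := fps_inv_seq f m in
    rcons s (- (f 0%N)^-1 * \sum_(i < m.+1) f (m.+1 - i)%N * s`_i)
  else [:: (f 0%N)^-1].

(* Multiplicative inverse, meaningful when [f 0 != 0]; see [fps_mulfV]. *)
Definition fps_inv (E : fieldType) (f : fps E) : fps E :=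
  fun n => (fps_inv_seq f n)`_n.

Definition fps_div (E : fieldType) (f g : fps E) : fps E :=
  fps_mul f (fps_inv g).

Definition L_fps (R : realType) (F : finFieldType) (X : Cinf_tower R F)
    (alpha : nat) : fps (Cinf X) :=
  fun k => sum_monic (fun a => (chi X a)`_k * A_to_Cinf X a ^- alpha).

Definition L_fun (R : realType) (F : finFieldType) (X : Cinf_tower R F)
    (alpha : nat) (t : Cinf X) : Cinf X :=
  sum_monic (fun a => (chi X a).[t] * A_to_Cinf X a ^- alpha).

Definition s_Car_fps (R : realType) (F : finFieldType) (X : Cinf_tower R F)
    (pi_ : Cinf X) : fps (Cinf X) :=
  fun i => e_Car (pi_ / theta X ^+ i.+1).

Definition s_Car_fun (R : realType) (F : finFieldType) (X : Cinf_tower R F)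
    (pi_ t : Cinf X) : Cinf X :=
  sum_nat (fun i => e_Car (pi_ / theta X ^+ i.+1) * t ^+ i).

Lemma poly_avM (R : realType) (F : finFieldType) (a b : {poly F}) :
  poly_av R (a * b) = poly_av R a * poly_av R b.
Proof.
rewrite /poly_av mulf_eq0; case: eqP => [|/eqP a0]; first by rewrite mul0r.
case: eqP => [|/eqP b0] /=; first by rewrite mulr0.
rewrite -exprD size_mul //; congr (_ ^+ _).
have := a0; have := b0; rewrite -!size_poly_gt0.
by case: (size a) => // m; case: (size b) => // n _ _; rewrite addnS addSn.
Qed.

Lemma frac_avE (R : realType) (F : finFieldType) (a b : {poly F}) : b != 0 ->
  frac_av R (FracField.tofrac a / FracField.tofrac b)
    = poly_av R a / poly_av R b.
Proof.
have av0 (c : {poly F}) : c != 0 -> poly_av R c != 0.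
  move=> c0; rewrite /poly_av (negbTE c0) expf_neq0 // pnatr_eq0.
  by rewrite -lt0n; apply/card_gt0P; exists 0.
move=> b0; rewrite /frac_av; pose x := FracField.tofrac a / FracField.tofrac b; rewrite -/x.
have d0 : (frac (repr x)).2 != 0 by apply: denom_ratioP.
apply/eqP; rewrite eqr_div ?av0 // -!poly_avM; apply/eqP; congr (poly_av R _).
have -> : x = \pi_(FracField.type {poly F})%qT (Ratio a b).
  rewrite /x; unlock FracField.tofrac.
  rewrite -[X in _ * X]FracField.pi_inv -[LHS]FracField.pi_mul.
  rewrite /FracField.mulf /FracField.invf.
  by rewrite !numden_Ratio ?oner_neq0 // mulr1 mul1r.
have := FracField.equivf_l (Ratio a b).
by rewrite !numden_Ratio // [a * _]mulrC.
Qed.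

Lemma av_lim_unique (R : realType) (E : fieldType) (av : E -> R) (T : Type)
    (D : set_system T) (FD : ProperFilter D) (u : T -> E) (l : E) :
  absolute_value av -> av_cvg av D u l -> av_lim av D u = l.
Proof.
move=> avP ul; apply: xget_subset1 => //= l1 l2 u1 u2.
have avN z : av (- z) = av z.
  have a1 : av (-1) ^+ 2 = 1 ^+ 2.
    rewrite expr2 -(avM avP) mulrNN mulr1 expr1n.
    have n0 : av 1 != 0 by apply/eqP => /(av_eq0 avP)/eqP; rewrite oner_eq0.
    by apply: (mulfI n0); rewrite -(avM avP) !mulr1.
  rewrite -mulN1r (avM avP) -[RHS]mul1r; congr (_ * _).
  by apply/eqP; rewrite -(eqrXn2 (n := 2)) ?(av_ge0 avP) // a1.
apply/subr0_eq/(av_eq0 avP)/eqP; rewrite eq_le (av_ge0 avP) andbT.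
apply/ler_addgt0Pr => e e0; rewrite add0r.
move/cvgrPdist_lt/(_ e e0): u1 => u1; move/cvgrPdist_lt/(_ e e0): u2 => u2.
have [x [h1 h2]] := filter_ex (filterI u1 u2).
rewrite /= !sub0r !normrN !ger0_norm ?(av_ge0 avP) // in h1 h2.
have -> : l1 - l2 = - (u x - l1) + (u x - l2) by rewrite opprB addrA subrK.
apply: le_trans (av_ultra avP _ _) _; rewrite avN.
by rewrite ge_max !ltW.
Qed.

Lemma fps_inv_seqE (E : fieldType) (f : fps E) n i : (i <= n)%N ->
  (fps_inv_seq f n)`_i = fps_inv f i.
Proof.
have sz m : size (fps_inv_seq f m) = m.+1.
  by elim: m => //= m IH; rewrite size_rcons IH.
elim: n => [|n IH]; first by rewrite leqn0 => /eqP ->.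
rewrite leq_eqVlt => /predU1P[->//|]; rewrite ltnS => le_in.
by rewrite /= nth_rcons sz ltnS le_in IH.
Qed.

Lemma fps_mulfV (E : fieldType) (f : fps E) : f 0%N != 0 ->
  fps_mul f (fps_inv f) =1 fps_of_poly 1.
Proof.
move=> f0 [|n].
  by rewrite /fps_mul big_ord_recl big_ord0 addr0 /fps_inv /= mulfV // /fps_of_poly coef1.
rewrite /fps_mul /fps_of_poly coef1 /= big_ord_recl /= subn0.
have -> : fps_inv f n.+1 =
    - (f 0%N)^-1 * \sum_(i < n.+1) f (n.+1 - i)%N * fps_inv f i.
  rewrite /fps_inv /= nth_rcons.
  have -> : size (fps_inv_seq f n) = n.+1.
    by elim: (n) => //= m IH; rewrite size_rcons IH.
  rewrite ltnn eqxx; congr (_ * _); apply: eq_bigr => i _.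
  by rewrite fps_inv_seqE // -ltnS.
rewrite mulrA mulrN mulfV // mulN1r.
rewrite (reindex_inj rev_ord_inj) /= addrC.
apply/eqP; rewrite subr_eq0; apply/eqP; apply: eq_bigr => i _.
by rewrite /bump /= add1n subSS subSn ?leq_subr // subKn // -ltnS.
Qed.

(* Main.v *)
Require Import Defs.
From mathcomp Require Import all_boot all_order all_algebra.
From mathcomp Require Import all_fingroup all_solvable all_field ring finmap.
From mathcomp Require Import all_classical all_reals all_analysis.
From mathcomp.analysis.showcase Require Import summability.
Set Implicit Arguments.
Unset Strict Implicit.
Unset Printing Implicit Defensive.
Import Order.TTheory GRing.Theory Num.Theory.
Import numFieldNormedType.Exports.
Local Open Scope ring_scope.

(* Write c_i = theta^(q^i).  For monic a of degree <= N, the polynomial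
   P_N(X) = sum_a a(X)/a takes at c_i the value sum_a a^(q^i - 1), which is 1 for
   i = 0 and, being a sum over F_q^(N+1) of a product of i(q-1) linear forms,
   vanishes for 1 <= i <= N.  Hence P_N = prod_(1 <= i <= N) (X - c_i)/(theta - c_i).
   On the other side, the partial fractions of
   lam prod_(i <= N) (1 - X/c_i)^-1 are sum_n r_(N,n)/(c_n - X), where
   r_(N,n) = pi_(N-n)^(q^n)/d_n and pi_M is the M-th partial product of the period.
   So (X - theta) P_N(X) sum_n r_(N,n)/(c_n - X) = - pi_N exactly.  As N grows,
   r_(N,n) tends to pi^(q^n)/d_n with an absolute value independent of N and
   tending to 0 in n, and a non-archimedean Tannery theorem turns the i-th
   coefficient of the last factor into e_Car(pi/theta^(i+1)). *)

(** * Interpolation and power sums *)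

Section Interpolation.
Variables (E : fieldType) (c : nat -> E).

Lemma poly_eq_on_nodes n (p r : {poly E}) :
    {in gtn n &, injective c} ->
    (size p <= n)%N -> (size r <= n)%N ->
    (forall i, (i < n)%N -> p.[c i] = r.[c i]) ->
  p = r.
Proof.
move=> cinj sp sr prE; apply/eqP; rewrite -subr_eq0; apply/eqP.
apply: (@roots_geq_poly_eq0 _ _ [seq c i | i <- iota 0 n]).
- apply/allP => y /mapP[i]; rewrite mem_iota => /andP[_ lt_in] ->.
  by rewrite rootE !hornerE prE ?subrr.
- rewrite map_inj_in_uniq ?iota_uniq // => i j.
  by rewrite !mem_iota; apply: cinj.
by rewrite size_map size_iota (leq_trans (size_polyD _ _)) // geq_max size_polyN sp sr.
Qed.

Lemma horner_prod_nodes n m k :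
  (\prod_(0 <= i < n | i != m) ((c i)%:P - 'X)).[c k] =
  \prod_(0 <= i < n | i != m) (c i - c k).
Proof. by rewrite horner_prod; apply: eq_bigr => i _; rewrite !hornerE. Qed.

(** Lagrange interpolation of a constant: both sides have degree at most [N] and agree at the [N.+1]
    nodes, since at [c i] only the [i]-th summand survives. Dividing by the full product of the
    [c m - X] would give a partial fraction expansion. *)
Lemma lagrange_const N (K : E) :
    {in gtn N.+1 &, injective c} ->
  \sum_(0 <= n < N.+1) (K / \prod_(0 <= m < N.+1 | m != n) (c m - c n)) *:
     \prod_(0 <= m < N.+1 | m != n) ((c m)%:P - 'X) = K%:P.
Proof.
move=> cinj; apply: (poly_eq_on_nodes cinj).
- rewrite big_nat; apply: (leq_trans (size_sum _ _ _)); apply/bigmax_leqP_seq => n.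
  rewrite mem_index_iota /= => lt_nN _.
  apply: leq_trans (size_scale_leq _ _) _.
  pose s := rem n (index_iota 0 N.+1).
  have sz_s : size s = N by rewrite size_rem ?mem_index_iota // size_iota subn0.
  have -> : \prod_(0 <= m < N.+1 | m != n) ((c m)%:P - 'X) =
     \prod_(m <- s) ((-1)%:P * ('X - (c m)%:P)).
    rewrite /s rem_filter ?iota_uniq // big_filter.
    by apply: eq_bigr => m _; rewrite mul_polyC scaleN1r opprB.
  rewrite big_split /= -rmorph_prod mul_polyC.
  apply: leq_trans (size_scale_leq _ _) _.
  by rewrite size_prod_XsubC sz_s.
- exact: leq_trans (size_polyC_leq1 _) _.
move=> i lt_iN; rewrite hornerC horner_sum (bigD1_seq i) ?mem_index_iota ?iota_uniq //=.
rewrite [X in _ + X]big1 => [|n ni]; last first.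
  rewrite hornerZ horner_prod_nodes.
  rewrite (_ : \prod_(0 <= m < _ | m != n) (c m - c i) = 0) ?mulr0 //.
  apply/eqP; rewrite prodf_seq_eq0; apply/hasP; exists i; first by rewrite mem_index_iota.
  by rewrite eq_sym ni subrr eqxx.
rewrite addr0 hornerZ horner_prod_nodes divfK //.
rewrite prodf_seq_neq0; apply/allP => m; rewrite mem_index_iota => /andP[_ lt_mN].
by apply/implyP => nmi; rewrite subr_eq0 (inj_in_eq cinj).
Qed.
End Interpolation.

Section PowerSums.
Variable F : finFieldType.

Lemma card_finField_natr : #|F|%:R = 0 :> F.
Proof. by rewrite -FinRing.zmodXgE -cardsT expg_cardG // inE. Qed.

(** For [e > 0], multiplication by a nonzero [g] with [g ^+ e != 1] permutes [F] and scales the sum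
    by [g ^+ e]. For [e = 0] the sum is [#|F|], which is zero in [F]. *)
Lemma sum_expr_finField e : (e < #|F|.-1)%N -> \sum_(x : F) x ^+ e = 0.
Proof.
case: e => [_|e lt_eq].
  under eq_bigr do rewrite expr0.
  by rewrite sumr_const card_finField_natr.
(* Otherwise all [#|F|.-1] nonzero elements would be roots of ['X^(e.+1) - 1], whose degree is
   smaller. *)
have [g /andP[g0 ge1]] : exists g : F, (g != 0) && (g ^+ e.+1 != 1).
  apply/existsP; rewrite -[X in is_true X]negbK negb_exists; apply/negP => /forallP nog.
  have : (size [seq x <- enum F | x != 0%R] < size ('X^(e.+1) - 1 : {poly F})%R)%N.
    apply: max_poly_roots.
    - by rewrite -size_poly_gt0 size_XnsubC.
    - apply/allP => x; rewrite mem_filter => /andP[x0 _].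
      rewrite rootE !hornerE subr_eq0.
      by have := nog x; rewrite x0 negbK.
    - by rewrite filter_uniq // enum_uniq.
  rewrite size_XnsubC // size_filter (eq_count (a2 := mem (predC1 0))) //.
  rewrite enumT -size_filter -cardE cardC1.
  by rewrite ltnNge => /negP; apply.
have : g ^+ e.+1 * (\sum_(x : F) x ^+ e.+1) = \sum_(x : F) x ^+ e.+1.
  rewrite mulr_sumr [RHS](reindex_inj (mulfI g0)).
  by apply: eq_bigr => x _; rewrite exprMn.
move/eqP; rewrite -subr_eq0 -{2}[\sum_(_ : F) _]mul1r -mulrBl mulf_eq0 subr_eq0.
by rewrite (negbTE ge1) => /eqP.
Qed.

(* A monomial of degree less than [m * (q - 1)] in [m] variables has some
   exponent smaller than [q - 1], and then sums to zero. *)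
Lemma sum_prod_linear_forms (E : fieldType) (phi : {rmorphism F -> E}) m
    (I : finType) (l : I -> 'I_m -> E) : (#|I| < m * #|F|.-1)%N ->
  \sum_(v : 'rV[F]_m) \prod_(k : I) \sum_(j < m) phi (v 0 j) * l k j = 0.
Proof.
move=> ltI; under eq_bigr do rewrite bigA_distr_bigA.
rewrite exchange_big big1 // => f _.
under eq_bigr do rewrite big_split.
rewrite -mulr_suml /=.
suff -> : \sum_(v : 'rV[F]_m) \prod_k phi (v 0 (f k)) = 0 by rewrite mul0r.
pose n j := #|[pred k | f k == j]|.
have [j ltj] : exists j, (n j < #|F|.-1)%N.
  apply/existsP; rewrite -[X in is_true X]negbK negb_exists; apply/negP => /forallP nj.
  move: ltI; rewrite ltnNge => /negP; apply.
  rewrite -[X in (_ <= X)%N]sum1_card (partition_big f xpredT) //=.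
  rewrite -[X in (X * _)%N]card_ord -sum_nat_const; apply: leq_sum => j _.
  by rewrite sum1_card leqNgt nj.
have -> : \sum_(v : 'rV[F]_m) \prod_k phi (v 0 (f k)) =
    phi (\sum_(v : 'rV[F]_m) \prod_j v 0 j ^+ n j).
  rewrite rmorph_sum; apply: eq_bigr => v _; rewrite rmorph_prod.
  rewrite (partition_big f xpredT) //=; apply: eq_bigr => i _.
  rewrite rmorphXn -prodr_const; apply: eq_big => // k /eqP <- //.
(* Indexing vectors by finite functions lets the sum factor into one power sum per coordinate. *)
rewrite (reindex (fun v : {ffun 'I_m -> F} => \row_i v i)) /=; last first.
  exists (fun v : 'rV[F]_m => [ffun i => v 0 i]) => v _.
    by apply/ffunP => i; rewrite ffunE mxE.
  by apply/rowP => i; rewrite mxE ffunE.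
under eq_bigr do under eq_bigr do rewrite mxE.
rewrite -(bigA_distr_bigA (fun j (x : F) => x ^+ n j)) (bigD1 j) //=.
by rewrite sum_expr_finField // mul0r rmorph0.
Qed.
End PowerSums.

(** * Identities at finite level *)

Section Carlitz.
Variables (F : finFieldType) (E : fieldType) (iota : {rmorphism {poly F} -> E}).
Local Notation q := #|F|.
Local Notation th := (iota 'X).
Local Notation c i := (th ^+ (q ^ i)).
Local Notation chiE := (map_poly (fun x : F => iota x%:P)).

(** [E] receives [F], so it has the same characteristic, of which [q] is a power; hence
    [x ^+ (q ^ n)] is additive on [E]. *)
Lemma pnat_card_finField n : [pchar E].-nat (q ^ n)%N.
Proof.
rewrite pnatX; apply/orP; left.
have [p pr_p pF] := finPcharP F.
have /= : p.-nat #|[set: F]| by have := fin_ring_pchar_abelem pF; case/andP.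
rewrite cardsT; apply: sub_in_pnat => r _ /eqP ->.
exact: (rmorph_pchar (iota \o polyC)).
Qed.

Lemma card_natr_eq0 : q%:R = 0 :> E.
Proof. by rewrite -(rmorph_nat (iota \o polyC)) card_finField_natr rmorph0. Qed.

Lemma frobD n x y : (x + y) ^+ (q ^ n) = x ^+ (q ^ n) + y ^+ (q ^ n) :> E.
Proof. exact/exprDn_pchar/pnat_card_finField. Qed.

Lemma frobN n x : (- x) ^+ (q ^ n) = - x ^+ (q ^ n) :> E.
Proof. exact/exprNn_pchar/pnat_card_finField. Qed.

Lemma frobB n x y : (x - y) ^+ (q ^ n) = x ^+ (q ^ n) - y ^+ (q ^ n) :> E.
Proof. by rewrite frobD frobN. Qed.

Lemma exprX_card (x : F) n : x ^+ (q ^ n) = x.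
Proof. by elim: n => [|n IH]; rewrite ?expr1 // expnS mulnC exprM IH expf_card. Qed.

(** The [q]-th power map fixes the constants of [F], so raising [iota a] to the power [q ^ i] only
    moves [th] to [c i]. *)
Lemma horner_chi i a : (chiE a).[c i] = iota a ^+ (q ^ i).
Proof.
rewrite -[chiE]/(map_poly (iota \o polyC)).
elim/poly_ind: a => [|a x IH].
  by rewrite !rmorph0 horner0 expr0n expn_eq0 -[_ == 0]negbK -lt0n ltnW ?finNzRing_gt1.
rewrite !rmorphD !rmorphM /= map_polyX map_polyC !hornerE IH frobD exprMn.
by congr (_ + _); rewrite -!rmorphXn /= exprX_card.
Qed.

Hypothesis iota_inj : injective iota.

Lemma theta_frob_inj : injective (fun i => c i).
Proof.
move=> i j; rewrite -!rmorphXn => /iota_inj /(congr1 (size : {poly F} -> nat)).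
by rewrite !size_polyXn => -[] /eqP; rewrite eqn_exp2l ?finNzRing_gt1 // => /eqP.
Qed.

Lemma iota_eq0 a : (iota a == 0) = (a == 0).
Proof. by rewrite -(inj_eq iota_inj) rmorph0. Qed.

(** Each nonzero vector is a unique nonzero scalar times a monic one. Grouping by leading
    coefficient gives [q - 1] copies of the monic sum, and [q - 1] is [-1] in [E]. *)
Lemma sum_rV_monic m (g : 'rV[F]_m -> E) :
    (forall x v, x != 0 -> g (x *: v) = g v) ->
  \sum_(v : 'rV[F]_m | rVpoly v \is monic) g v = - \sum_(v | v != 0) g v.
Proof.
move=> gZ; pose lc (v : 'rV[F]_m) := lead_coef (rVpoly v).
have lc0 v : (lc v != 0) = (v != 0).
  by rewrite lead_coef_eq0 raddf_eq0 //; exact: (can_inj rVpolyK).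
rewrite [X in - X](partition_big lc (fun x => x != 0)) => [|v v0]; last by rewrite lc0.
rewrite (eq_bigr (fun => \sum_(v : 'rV[F]_m | rVpoly v \is monic) g v)); last first.
  move=> x x0; rewrite (reindex (fun v => x *: v)) /=; last first.
    by exists (fun v => x^-1 *: v) => v _; rewrite scalerA ?mulVf ?mulfV ?scale1r.
  apply: eq_big => [v|v _]; last exact: gZ.
  rewrite -lc0 /lc linearZ lead_coefZ mulf_eq0 negb_or x0 /= monicE.
  rewrite -[X in _ * _ == X]mulr1 (inj_eq (mulfI x0)) andbC.
  by case: eqP => // ->; rewrite oner_eq0.
rewrite sumr_const (_ : #|_| = q.-1); last by rewrite -(cardC1 0); apply: eq_card.
rewrite -[_ *+ _]mulr_natl -subn1 natrB ?card_natr_eq0; last exact: ltnW (finNzRing_gt1 F).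
by rewrite sub0r mulN1r opprK.
Qed.

Lemma sum_rV_frob N i : (i < N.+1)%N ->
  \sum_(v : 'rV[F]_N.+1 | rVpoly v \is monic)
     iota (rVpoly v) ^+ (q ^ i) / iota (rVpoly v) = (i == 0%N)%:R.
Proof.
have q1 := finNzRing_gt1 F; have q0 : (0 < q)%N := ltnW q1.
move=> lt_iN; rewrite (eq_bigr (fun v => iota (rVpoly v) ^+ (q ^ i).-1)); last first.
  move=> v /monic_neq0 v0; rewrite -[in LHS](prednK (_ : 0 < q ^ i)%N) ?expn_gt0 ?q0 //.
  by rewrite exprSr mulfK // iota_eq0.
rewrite sum_rV_monic; last first.
  move=> x v x0; rewrite linearZ /= -mul_polyC rmorphM exprMn -[RHS]mul1r.
  congr (_ * _); rewrite -rmorphXn -polyC_exp.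
  suff -> : x ^+ (q ^ i).-1 = 1 by rewrite rmorph1.
  by apply: (mulfI x0); rewrite -exprS prednK ?expn_gt0 ?q0 // exprX_card mulr1.
(* For [i = 0] every term is 1, and the number [q ^ N.+1 - 1] of nonzero vectors is [-1] in [E]. *)
case: i lt_iN => [|i] lt_iN.
  under eq_bigr do rewrite expr0.
  rewrite sumr_const (_ : #|_| = (q ^ N.+1).-1); last first.
    have <- : #|{: 'rV[F]_N.+1}| = (q ^ N.+1)%N by rewrite card_mx mul1n.
    by rewrite -(cardC1 (0 : 'rV_N.+1)); apply: eq_card.
  by rewrite -subn1 natrB ?expn_gt0 ?q0 // natrX card_natr_eq0 expr0n sub0r opprK.
have e0 : (0 < (q ^ i.+1).-1)%N.
  by rewrite -ltnS prednK ?expn_gt0 ?q0 // (leq_trans q1) // -{1}[q]expn1 leq_exp2l.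
have -> : \sum_(v : 'rV[F]_N.+1 | v != 0) iota (rVpoly v) ^+ (q ^ i.+1).-1 =
          \sum_(v : 'rV[F]_N.+1) iota (rVpoly v) ^+ (q ^ i.+1).-1.
  by rewrite [RHS](bigD1 0) //= linear0 rmorph0 expr0n gtn_eqF // add0r.
apply/eqP; rewrite oppr_eq0; apply/eqP.
(* As [q ^ i.+1 - 1 = (q - 1) * (1 + q + ... + q ^ i)], each term is a product of [i.+1 * (q - 1)]
   factors [iota a ^+ (q ^ k)], which are linear in the coordinates by [horner_chi]. Their number is
   below [N.+1 * (q - 1)]. *)
rewrite -[RHS](@sum_prod_linear_forms F E (iota \o polyC) N.+1 ('I_i.+1 * 'I_q.-1)%type
   (fun k j => c k.1 ^+ j)); last first.
  by rewrite card_prod !card_ord ltn_mul2r -ltnS prednK // q1.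
apply: eq_bigr => v _.
rewrite -(pair_bigA _ (fun (k : 'I_i.+1) (_ : 'I_q.-1) =>
   \sum_(j < N.+1) (iota \o polyC) (v 0 j) * c k ^+ j)) /=.
under [RHS]eq_bigr => k _.
  rewrite prodr_const card_ord (_ : \sum_(j < _) _ = iota (rVpoly v) ^+ (q ^ k));
    last first.
    rewrite -horner_chi (@horner_coef_wide _ N.+1).
      apply: eq_bigr => j _; rewrite coef_map_id0 ?polyC0 ?rmorph0 //.
      by rewrite coef_rVpoly_ord.
    by rewrite (size_map_poly (iota \o polyC)) size_poly.
  over.
rewrite predn_exp mulnC big_distrl /= -prodrXr.
by apply: eq_bigr => k _; rewrite exprM.
Qed.

(** Both sides have degree at most [N], take the value 1 at [c 0] and vanish at [c 1, ..., c N]. *)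
Lemma monic_sum_prod N :
  \sum_(v : 'rV[F]_N.+1 | rVpoly v \is monic)
     (iota (rVpoly v))^-1 *: chiE (rVpoly v) =
  \prod_(1 <= i < N.+1) ((c 0 - c i)^-1 *: ('X - (c i)%:P)).
Proof.
apply: (@poly_eq_on_nodes E (fun i => c i) N.+1) => [i j _ _ /theta_frob_inj //|||i lt_iN].
- apply: (leq_trans (size_sum _ _ _)); apply/bigmax_leqP => v _.
  apply: leq_trans (size_scale_leq _ _) _.
  by rewrite (size_map_poly (iota \o polyC)) size_poly.
- rewrite scaler_prod; apply: leq_trans (size_scale_leq _ _) _.
  by rewrite size_prod_XsubC size_iota subn1.
rewrite horner_sum.
rewrite (eq_bigr (fun v : 'rV_N.+1 => iota (rVpoly v) ^+ (q ^ i) / iota (rVpoly v)));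
  last by move=> v _; rewrite hornerZ horner_chi mulrC.
rewrite sum_rV_frob // horner_prod; case: i lt_iN => [|i] lt_iN /=.
  rewrite big_nat big1 // => i /andP[i1 _]; rewrite !hornerE mulVf // subr_eq0.
  by apply/negP => /eqP /theta_frob_inj i0; rewrite -i0 in i1.
apply/esym/eqP; rewrite prodf_seq_eq0; apply/hasP; exists i.+1.
  by rewrite mem_index_iota.
by rewrite /= !hornerE subrr mulr0.
Qed.

Lemma th_neq0 : th != 0.
Proof. by rewrite iota_eq0 polyX_eq0. Qed.

Lemma geometric_poly (x : E) K : x != 0 ->
  (x%:P - 'X) * \poly_(i < K) x^-1 ^+ i.+1 = 1 - x^-1 ^+ K *: 'X^K.
Proof.
move=> x0; rewrite poly_def; elim: K => [|K IH].
  by rewrite big_ord0 mulr0 !expr0 scale1r subrr.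
rewrite big_ord_recr /= mulrDr IH mulrBl mul_polyC scalerA -scalerAr -exprS.
by rewrite {1}exprS mulVKf // addrA subrK.
Qed.

(** * Partial products of the period and partial fractions *)

Variable lam : E.
Hypothesis lamE : lam ^+ (q - 1) = - th.

Definition period_part M := th * lam *
  \prod_(1 <= i < M.+1) (1 - th ^ (1 - (q ^ i)%N%:Z))^-1.

Definition d_ n := \prod_(1 <= j < n.+1) (c j - th) ^+ (q ^ (n - j)).

(** For [n > N] the subtraction truncates to [0]; the sums below only use [n <= N]. *)
Definition residue N n := period_part (N - n) ^+ (q ^ n) / d_ n.

Lemma period_factorE i : 1 - th ^ (1 - (q ^ i)%N%:Z) = (c i - th) / c i.
Proof.
rewrite expfzDr ?th_neq0 // expr1z -exprnN mulrBl divff //.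
by rewrite expf_neq0 // th_neq0.
Qed.

(** Frobenius gives [(c j - th) ^+ (q ^ (n - j)) = c n - c (n - j)]; the order of the factors is
    then reversed. *)
Lemma d_E n : d_ n = \prod_(0 <= m < n) (c n - c m).
Proof.
rewrite /d_ big_add1 /= [RHS]big_nat_rev add0n big_nat [RHS]big_nat.
apply: eq_bigr => j /andP[_ lt_jn].
by rewrite frobB -exprM -expnD subnKC.
Qed.

Lemma lam_frob n : lam ^+ (q ^ n) = lam * \prod_(0 <= m < n) - c m.
Proof.
elim: n => [|n IH]; first by rewrite big_nil expr1 mulr1.
rewrite big_nat_recr //= expnS exprM -(subnKC (ltnW (finNzRing_gt1 F))) exprD expr1.
by rewrite subnKC ?(ltnW (finNzRing_gt1 F)) // lamE exprMn frobN IH mulrA.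
Qed.

(** Raising to the power [q ^ n] shifts indices by [n]: the partial product supplies the nodes
    beyond [n], [th] becomes [c n], and [lam_frob] supplies the nodes below [n]. *)
Lemma residueE N n : (n <= N)%N -> residue N n =
  lam * \prod_(0 <= m < N.+1) c m / \prod_(0 <= m < N.+1 | m != n) (c m - c n).
Proof.
move=> le_nN; rewrite /residue /period_part.
under eq_bigr do rewrite period_factorE invf_div.
rewrite !exprMn -prodrXl lam_frob d_E.
have -> : \prod_(1 <= i < (N - n).+1) (c i / (c i - th)) ^+ (q ^ n) =
    \prod_(n.+1 <= m < N.+1) (c m / (c m - c n)).
  rewrite -[n.+1]add1n big_addn subSn //; apply: eq_bigr => i _.
  by rewrite expr_div_n frobB -exprM -expnD.
have -> : \prod_(0 <= m < N.+1 | m != n) (c m - c n) =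
    \prod_(0 <= m < n) (c m - c n) * \prod_(n.+1 <= m < N.+1) (c m - c n).
  rewrite (big_cat_nat (n := n)) ?leqW //= [X in _ * X]big_ltn_cond ?ltnS // eqxx /=.
  congr (_ * _); rewrite big_nat_cond [RHS]big_nat_cond; apply: eq_bigl => m;
    rewrite andbT; apply: andb_idr => /andP[m1 m2].
    by rewrite (ltn_eqF m2).
  by rewrite (gtn_eqF m1).
rewrite [X in _ = lam * X / _](big_cat_nat (n := n)) ?leqW //=.
rewrite [X in _ = lam * (_ * X) / _]big_ltn ?ltnS //.
have -> : \prod_(0 <= m < n) (c n - c m) = \prod_(0 <= m < n) - (c m - c n).
  by apply: eq_bigr => m _; rewrite opprB.
have prodN (f : nat -> E) : \prod_(0 <= m < n) - f m = (-1) ^+ n * \prod_(0 <= m < n) f m.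
  by under eq_bigr do rewrite -mulN1r; rewrite big_split prodr_const_nat subn0.
rewrite prodf_div !prodN !invfM invr_sign.
(* The sign from [lam_frob] and the sign from reversing the differences in [d_ n] are both
   [(-1) ^+ n] and cancel. *)
set s := (-1) ^+ n; have s2 : s * s = 1 by rewrite -expr2 sqrr_sign.
by rewrite -[RHS]mul1r -s2; ring.
Qed.

Lemma c_sub_th_neq0 i : (0 < i)%N -> c i - th != 0.
Proof.
by move=> i0; rewrite subr_eq0; apply/negP => /eqP/(@theta_frob_inj i 0%N) i1; rewrite i1 in i0.
Qed.

Lemma prod_c_neq0 N : \prod_(1 <= i < N.+1) (c i - th) != 0.
Proof.
rewrite prodf_seq_neq0; apply/allP => i; rewrite mem_index_iota => /andP[i0 _].
exact: c_sub_th_neq0.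
Qed.

(** The case [n = 0] of [residueE], where the residue is the partial period itself. *)
Lemma period_part_prod N : period_part N * \prod_(1 <= i < N.+1) (c i - th) =
  lam * \prod_(0 <= m < N.+1) c m.
Proof.
have := residueE (leq0n N); rewrite /residue subn0 expn0 expr1 d_E big_nil divr1 => ->.
rewrite [X in _ / X](_ : _ = \prod_(1 <= i < N.+1) (c i - th)) ?divfK ?prod_c_neq0 //.
rewrite big_ltn_cond //= big_nat_cond [RHS]big_nat_cond expr1.
by apply: eq_bigl => m; rewrite andbT; apply: andb_idr => /andP[m1 _]; rewrite gtn_eqF.
Qed.

Lemma sum_residue N : \sum_(0 <= n < N.+1) residue N n *:
    \prod_(0 <= m < N.+1 | m != n) ((c m)%:P - 'X) =
  (lam * \prod_(0 <= m < N.+1) c m)%:P.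
Proof.
rewrite -(@lagrange_const _ (fun i => c i) N) => [|i j _ _ /theta_frob_inj //].
by apply: eq_big_nat => n /andP[_ ltn]; rewrite residueE.
Qed.

(* The expansion of [\sum_n residue N n / (c_n - X)] truncated at [X^K]; [omega_rem]
   is the resulting error term in [omega_identity]. *)
Definition omega_trunc N K :=
  \sum_(0 <= n < N.+1) residue N n *: \poly_(i < K) (c n)^-1 ^+ i.+1.

Definition omega_rem N K :=
  \sum_(0 <= n < N.+1)
    (residue N n * (c n)^-1 ^+ K / \prod_(1 <= i < N.+1) (c i - th)) *:
      \prod_(0 <= m < N.+1 | m != n) ((c m)%:P - 'X).

(** By [monic_sum_prod], the factor ['X - th] completes the product to all nodes [c 0, ..., c N].
    Each [c n - X] cancels its geometric series up to a multiple of ['X^K], and [sum_residue]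
    collapses what remains to a constant. *)
Lemma omega_identity N K :
  ('X - th%:P) * omega_trunc N K *
    \sum_(v : 'rV[F]_N.+1 | rVpoly v \is monic)
      (iota (rVpoly v))^-1 *: chiE (rVpoly v) =
  - (period_part N)%:P + 'X^K * omega_rem N K.
Proof.
set a := \prod_(1 <= i < N.+1) (c i - th).
have a0 : a != 0 by apply: prod_c_neq0.
have -> : ('X - th%:P) * omega_trunc N K *
    \sum_(v : 'rV[F]_N.+1 | rVpoly v \is monic)
      (iota (rVpoly v))^-1 *: chiE (rVpoly v) =
   - a^-1 *: (\prod_(0 <= m < N.+1) ((c m)%:P - 'X) * omega_trunc N K).
  rewrite monic_sum_prod [X in _ = _ *: (X * _)]big_ltn // expn0 expr1.
  set B := \prod_(1 <= i < N.+1) _.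
  have -> : B = a^-1 *: \prod_(1 <= m < N.+1) ((c m)%:P - 'X).
    rewrite /a -prodfV -scaler_prod; apply: eq_bigr => i _.
    by rewrite -opprB invrN scaleNr -scalerN opprB.
  by rewrite scaleNr -!mul_polyC; ring.
rewrite mulr_sumr.
have -> : \sum_(0 <= n < N.+1) \prod_(0 <= m < N.+1) ((c m)%:P - 'X) *
     (residue N n *: \poly_(i < K) (c n)^-1 ^+ i.+1) =
   (lam * \prod_(0 <= m < N.+1) c m)%:P - 'X^K * (a *: omega_rem N K).
  rewrite -sum_residue scaler_sumr mulr_sumr -sumrB.
  apply: eq_big_nat => n /andP[_ ltn].
  rewrite (bigD1_seq n) ?mem_index_iota ?iota_uniq //=.
  have := @geometric_poly (c n) K (expf_neq0 _ th_neq0); rewrite exprVn.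
  set g := \poly_(i < K) _; set M := \prod_(0 <= i < N.+1 | i != n) _ => gE.
  have -> : ((c n)%:P - 'X) * M * (residue N n *: g) =
      residue N n *: (M * (((c n)%:P - 'X) * g)) by rewrite -!mul_polyC; ring.
  have -> : a *: ((residue N n / c n ^+ K / a) *: M) = (residue N n / c n ^+ K) *: M.
    by rewrite scalerA mulrCA divff // mulr1.
  by rewrite gE -!mul_polyC; move: (residue N n) => r; rewrite polyCM; ring.
rewrite -period_part_prod -/a polyCM -!mul_polyC polyCN.
rewrite mulrBr -[RHS]mul1r -(_ : (a^-1)%:P * a%:P = 1); last by rewrite -polyCM mulVf.
ring.
Qed.
End Carlitz.

Local Open Scope classical_set_scope.

(** * Non-archimedean limits *)

Section AbsoluteValue.
Variables (R : realType) (E : fieldType) (av : E -> R).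
Hypothesis avP : absolute_value av.

Lemma av_0 : av 0 = 0. Proof. exact/(av_eq0 avP). Qed.

Lemma av_neq0 x : x != 0 -> av x != 0.
Proof. by apply: contra_neq => /(av_eq0 avP). Qed.

Lemma av_gt0 x : x != 0 -> 0 < av x.
Proof. by move=> /av_neq0 x0; rewrite lt0r x0 (av_ge0 avP). Qed.

Lemma av_1 : av 1 = 1.
Proof. by apply: (mulfI (av_neq0 (oner_neq0 E))); rewrite -(avM avP) !mulr1. Qed.

Lemma av_N x : av (- x) = av x.
Proof.
rewrite -mulN1r (avM avP) -[RHS]mul1r; congr (_ * _); apply/eqP.
by rewrite -(eqrXn2 (n := 2)) ?(av_ge0 avP) // expr2 -(avM avP) mulrNN mulr1 av_1 expr1n.
Qed.

Lemma av_X x n : av (x ^+ n) = av x ^+ n.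
Proof. by elim: n => [|n IH]; rewrite ?av_1 // !exprS (avM avP) IH. Qed.

Lemma av_V x : av x^-1 = (av x)^-1.
Proof.
have [->|x0] := eqVneq x 0; first by rewrite !invr0 av_0 invr0.
by apply: (mulfI (av_neq0 x0)); rewrite -(avM avP) !divff ?av_1 ?av_neq0.
Qed.

Lemma av_prod (I : Type) (r : seq I) (P : pred I) (f : I -> E) :
  av (\prod_(i <- r | P i) f i) = \prod_(i <- r | P i) av (f i).
Proof. exact: (big_morph av (avM avP) av_1). Qed.

Lemma av_le_max x y b : av x <= b -> av y <= b -> av (x + y) <= b.
Proof. by move=> xb yb; apply: le_trans (av_ultra avP _ _) _; rewrite ge_max xb. Qed.

Lemma av_sum_le (I : eqType) (r : seq I) (P : pred I) (f : I -> E) b : 0 <= b ->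
    (forall i, i \in r -> P i -> av (f i) <= b) ->
  av (\sum_(i <- r | P i) f i) <= b.
Proof.
move=> b0 fb; rewrite big_seq_cond.
apply: (big_ind (fun x => av x <= b)) => [|x y|i /andP[]]; rewrite ?av_0 //.
  exact: av_le_max.
exact: fb.
Qed.

(** If the sum were smaller than [x], then [x = (x + y) - y] would be smaller than itself. *)
Lemma av_addl x y : av y < av x -> av (x + y) = av x.
Proof.
move=> yx; apply/eqP; rewrite eq_le av_le_max ?(ltW yx) //=.
rewrite leNgt; apply/negP => xyx.
have := av_ultra avP (x + y) (- y); rewrite addrK av_N leNgt.
by rewrite gt_max xyx yx.
Qed.

Lemma av_subl x y : av y < av x -> av (x - y) = av x.
Proof. by move=> yx; apply: av_addl; rewrite av_N. Qed.

Section Limits.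
Context {T : Type} {D : set_system T} {FD : ProperFilter D}.
Implicit Types (u v : T -> E) (l : E).

Lemma av_cvg_squeeze u l (b : T -> R) :
    (\forall x \near D, av (u x - l) <= b x) -> b @ D --> 0 ->
  av_cvg av D u l.
Proof.
move=> ub b0; apply: (@squeeze_cvgr _ _ _ _ (fun=> 0) b) => //.
  by apply: filterS ub => x ->; rewrite (av_ge0 avP).
exact: cvg_cst.
Qed.

Lemma av_cvg_cst l : av_cvg av D (fun=> l) l.
Proof. by rewrite /av_cvg; under eq_fun do rewrite subrr av_0; exact: cvg_cst. Qed.

Lemma av_cvgD u v k l : av_cvg av D u k -> av_cvg av D v l ->
  av_cvg av D (fun x => u x + v x) (k + l).
Proof.
move=> uk vl; apply: (@av_cvg_squeeze _ _ (fun x => av (u x - k) + av (v x - l))).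
  apply: nearW => x; rewrite opprD addrACA av_le_max //.
    by rewrite lerDl (av_ge0 avP).
  by rewrite lerDr (av_ge0 avP).
by rewrite -[0]addr0; apply: cvgD.
Qed.

Lemma av_cvgM u v k l : av_cvg av D u k -> av_cvg av D v l ->
  av_cvg av D (fun x => u x * v x) (k * l).
Proof.
move=> uk vl; apply: (@av_cvg_squeeze _ _ (fun x =>
    av (u x - k) * av (v x - l) + av k * av (v x - l) + av (u x - k) * av l)).
  apply: nearW => x; rewrite -!(avM avP).
  have -> : u x * v x - k * l =
    (u x - k) * (v x - l) + k * (v x - l) + (u x - k) * l.
    by rewrite -mulrDl subrK mulrBr mulrBl addrA subrK.
  rewrite !av_le_max ?lerDl ?lerDr ?addr_ge0 ?(av_ge0 avP) //.
    by rewrite -addrA lerDl addr_ge0 ?(av_ge0 avP).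
  by rewrite addrAC lerDr addr_ge0 ?(av_ge0 avP).
have -> : 0 = 0 * 0 + av k * 0 + 0 * av l :> R by rewrite !mulr0 mul0r !addr0.
apply: cvgD; first apply: cvgD.
- exact: cvgM.
- by apply: cvgM => //; exact: cvg_cst.
- by apply: cvgM => //; exact: cvg_cst.
Qed.

Lemma av_cvgN u l : av_cvg av D u l -> av_cvg av D (fun x => - u x) (- l).
Proof. by rewrite /av_cvg; under [in X in _ -> X]eq_fun do rewrite -opprD av_N. Qed.

Lemma av_cvgX u l n : av_cvg av D u l -> av_cvg av D (fun x => u x ^+ n) (l ^+ n).
Proof.
move=> ul; elim: n => [|n IH]; first exact: av_cvg_cst.
by rewrite exprS; under eq_fun do rewrite exprS; exact: av_cvgM.
Qed.

Lemma av_cvg_sum (I : Type) (r : seq I) (P : pred I) (u : I -> T -> E) (l : I -> E) :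
    (forall i, P i -> av_cvg av D (u i) (l i)) ->
  av_cvg av D (fun x => \sum_(i <- r | P i) u i x) (\sum_(i <- r | P i) l i).
Proof.
move=> ul; elim: r => [|i r IH].
  by rewrite big_nil; under eq_fun do rewrite big_nil; exact: av_cvg_cst.
rewrite big_cons; under eq_fun do rewrite big_cons.
by case: ifP => // Pi; apply: av_cvgD => //; exact: ul.
Qed.

Lemma av_cvg_unique u k l : av_cvg av D u k -> av_cvg av D u l -> k = l.
Proof.
by move=> uk ul; rewrite -(av_lim_unique FD avP uk) (av_lim_unique FD avP ul).
Qed.

Lemma av_cvg_le u l b : av_cvg av D u l -> (forall x, av (u x) <= b) -> av l <= b.
Proof.
move=> ul ub; have b0 : 0 <= b.
  by have [x _] := @filter_ex _ D _ _ filterT; exact: le_trans (av_ge0 avP _) (ub x).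
apply/ler_addgt0Pr => e e0.
have /cvgrPdist_lt/(_ e e0) ule := ul.
have [x] := filter_ex ule; rewrite /= sub0r normrN ger0_norm ?(av_ge0 avP) // => xe.
have -> : l = u x + - (u x - l) by rewrite opprB addrC subrK.
rewrite av_le_max ?av_N //; first by apply: ler_wpDr; [exact: ltW | exact: ub].
by apply: ler_wpDl => //; exact: ltW.
Qed.

(** As soon as [u x - l] is smaller than [b], subtracting it from [u x] does not change the absolute
    value. *)
Lemma av_cvg_av u l b : 0 < b -> av_cvg av D u l -> (forall x, av (u x) = b) -> av l = b.
Proof.
move=> b0 ul ub; have /cvgrPdist_lt/(_ b b0) ule := ul.
have [x] := filter_ex ule; rewrite /= sub0r normrN ger0_norm ?(av_ge0 avP) // => xe.
have -> : l = u x - (u x - l) by rewrite opprB addrC subrK.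
by rewrite av_subl ub.
Qed.

End Limits.

Lemma av_cvg_nat u l : av_cvg av \oo u l <->
  forall e, 0 < e -> exists N, forall n, (N <= n)%N -> av (u n - l) < e.
Proof.
split=> [ul e e0|H].
  have /cvgrPdist_lt/(_ e e0) [N _ Nu] := ul.
  exists N => n Nn; have := Nu n Nn.
  by rewrite /= sub0r normrN ger0_norm ?(av_ge0 avP).
apply/cvgrPdist_lt => e /H[N Nu]; exists N => // n /Nu.
by rewrite /= sub0r normrN ger0_norm ?(av_ge0 avP).
Qed.

Lemma cvg0_le (b : nat -> R) e : 0 < e -> b @ \oo --> 0 ->
  exists N, forall n, (N <= n)%N -> b n <= e.
Proof.
move=> e0 /cvgrPdist_lt/(_ e e0)[N _ Nb]; exists N => n /Nb; rewrite /= sub0r normrN.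
by move/ltW; apply: le_trans; exact: ler_norm.
Qed.

Lemma av_cvg_shift u l m : av_cvg av \oo u l -> av_cvg av \oo (fun n => u (n - m)%N) l.
Proof.
move=> /av_cvg_nat ul; apply/av_cvg_nat => e /ul[N Nu]; exists (N + m)%N => n Nn.
by apply: Nu; rewrite -(leq_add2r m) subnK // (leq_trans _ Nn) // leq_addl.
Qed.

Lemma av_cvgS u l : av_cvg av \oo u l -> av_cvg av \oo (fun n => u n.+1) l.
Proof.
move=> /av_cvg_nat ul; apply/av_cvg_nat => e /ul[N Nu]; exists N => n Nn.
exact/Nu/leqW.
Qed.

(** Cut at an [M] beyond which [b] is small: the tail is controlled by the largest term, by the
    ultrametric inequality, so [b] only has to tend to 0; the head is a finite sum of limits. *)
Lemma av_cvg_tannery (x : nat -> nat -> E) (y : nat -> E) (b : nat -> R) l :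
    b @ \oo --> 0 -> (forall N n, (n <= N)%N -> av (x N n) <= b n) ->
    (forall n, av (y n) <= b n) -> (forall n, av_cvg av \oo (x ^~ n) (y n)) ->
    av_cvg av \oo (fun N => \sum_(0 <= n < N) y n) l ->
  av_cvg av \oo (fun N => \sum_(0 <= n < N.+1) x N n) l.
Proof.
move=> b0 xb yb xy yl.
suff xy0 : av_cvg av \oo (fun N => \sum_(0 <= n < N.+1) x N n
                                   - \sum_(0 <= n < N.+1) y n) 0.
  rewrite -[l]add0r (_ : (fun N => _) = fun N => \sum_(0 <= n < N.+1) x N n
    - \sum_(0 <= n < N.+1) y n + \sum_(0 <= n < N.+1) y n).
    by apply: av_cvgD => //; exact: (av_cvgS yl).
  by apply/funext => N; rewrite subrK.
apply/av_cvg_nat => e e0.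
have e20 : 0 < e / 2 by rewrite divr_gt0.
have [M Mb] := cvg0_le e20 b0.
have /av_cvg_nat/(_ _ e20)[N NM] : av_cvg av \oo
    (fun N => \sum_(0 <= n < M) (x N n - y n)) (\sum_(0 <= n < M) (y n - y n)).
  by apply: av_cvg_sum => n _; apply: av_cvgD => //; exact: av_cvg_cst.
exists (maxn N M) => n; rewrite geq_max subr0 -sumrB => /andP[Nn Mn].
rewrite (big_cat_nat (n := M)) ?leqW //=.
have : av (\sum_(0 <= i < M) (x n i - y i)) <= e / 2.
  by have := NM n Nn; rewrite [X in _ - X]big1 ?subr0 => [/ltW|i _] //; rewrite subrr.
have : av (\sum_(M <= i < n.+1) (x n i - y i)) <= e / 2.
  apply: av_sum_le => [|i]; first exact: ltW.
  rewrite mem_index_iota => /andP[Mi ltin] _.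
  by rewrite av_le_max ?av_N // (le_trans _ (Mb _ Mi)) // xb.
move=> h1 h2; apply: le_lt_trans (av_le_max h2 h1) _.
by rewrite ltr_pdivrMr // mulr_natr mulr2n ltrDl.
Qed.

Hypothesis complete : forall u, av_cauchy av u -> exists l, av_cvg av \oo u l.

(** The difference of two partial sums is at most the largest term between them, so terms tending to
    0 make the partial sums Cauchy. *)
Lemma av_cvg_series (x : nat -> E) (b : nat -> R) : b @ \oo --> 0 ->
    (forall n, av (x n) <= b n) ->
  exists l, av_cvg av \oo (fun N => \sum_(0 <= n < N) x n) l.
Proof.
move=> b0 xb; apply: complete => e e0.
have e20 : 0 < e / 2 by rewrite divr_gt0.
have [N Nb] := cvg0_le e20 b0.
have lt_e2 : e / 2 < e by rewrite ltr_pdivrMr // mulr_natr mulr2n ltrDl.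
have H m n : (N <= m)%N -> (m <= n)%N ->
    av (\sum_(0 <= i < n) x i - \sum_(0 <= i < m) x i) < e.
  move=> Nm mn; apply: le_lt_trans lt_e2.
  rewrite (big_cat_nat (n := m)) //= addrAC subrr add0r.
  apply: av_sum_le => [|i]; first exact: ltW.
  rewrite mem_index_iota => /andP[mi _] _.
  exact: le_trans (xb i) (Nb i (leq_trans Nm mi)).
exists N => m n Nm Nn; have [mn|/ltnW nm] := leqP m n; last exact: H.
by rewrite -av_N opprB H.
Qed.

(** Telescoping: consecutive partial products differ by [p i * (f i.+1 - 1)] with [av (p i) = 1],
    which reduces the product to a series. *)
Lemma av_cvg_prod (f : nat -> E) (b : nat -> R) : b @ \oo --> 0 ->
    (forall i, (0 < i)%N -> av (f i) = 1) ->
    (forall i, av (f i.+1 - 1) <= b i) ->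
  exists l, av_cvg av \oo (fun M => \prod_(1 <= i < M.+1) f i) l.
Proof.
move=> b0 f1 fb; pose p M := \prod_(1 <= i < M.+1) f i.
have [M|l pl] := @av_cvg_series (fun i => p i * (f i.+1 - 1)) _ b0.
  rewrite (avM avP) /p av_prod big_nat big1 ?mul1r // => i /andP[i0 _]; exact: f1.
exists (1 + l); suff -> : (fun M => \prod_(1 <= i < M.+1) f i) =
    (fun M => 1 + \sum_(0 <= i < M) p i * (f i.+1 - 1)).
  by apply: av_cvgD => //; exact: av_cvg_cst.
apply/funext => M; elim: M => [|M IH].
  by rewrite !big_geq ?addr0.
rewrite big_nat_recr //= [X in _ + X]big_nat_recr //= addrA -IH.
by rewrite mulrBr mulr1 addrC subrK.
Qed.

(** * Unconditional sums over monic polynomials *)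

Section MonicSums.
Variable F : finFieldType.

Definition poly_below N : {fset {poly F}} := [fset rVpoly v | v : 'rV[F]_N]%fset.

Lemma in_poly_below N a : (a \in poly_below N) = (size a <= N)%N.
Proof.
apply/imfsetP/idP => [[v _ ->]|aN]; first exact: size_poly.
by exists (poly_rV a) => //; rewrite poly_rV_K.
Qed.

Lemma big_poly_below N (f : {poly F} -> E) :
  \sum_(a <- poly_below N | a \is monic) f a =
  \sum_(v : 'rV[F]_N | rVpoly v \is monic) f (rVpoly v).
Proof.
rewrite big_mkcond big_imfset /=; last by move=> v w _ _ /(can_inj rVpolyK).
by rewrite [RHS]big_mkcond big_enum.
Qed.

Lemma av_sum_monic_tail (f : {poly F} -> E) N (T : {fset {poly F}}) e :
    0 <= e -> (forall a, a \is monic -> (N < size a)%N -> av (f a) <= e) ->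
    (poly_below N `<=` T)%fset ->
  av (\sum_(a <- T | a \is monic) f a
      - \sum_(v : 'rV[F]_N | rVpoly v \is monic) f (rVpoly v)) <= e.
Proof.
move=> e0 fe NT; rewrite -big_poly_below.
have -> : \sum_(a <- T | a \is monic) f a =
    \sum_(a <- poly_below N | a \is monic) f a +
    \sum_(a <- (T `\` poly_below N)%fset | a \is monic) f a.
  rewrite [LHS]big_mkcond (big_fsetID _ (mem (poly_below N))) /=.
  congr (_ + _); rewrite [RHS]big_mkcond; apply: eq_fbigl => a; rewrite !inE /=.
    by apply/andP/idP => [[]//|aN]; rewrite aN (fsubsetP NT).
  by rewrite andbC.
rewrite addrAC subrr add0r; apply: av_sum_le => // a.
rewrite !inE in_poly_below -ltnNge => /andP[Na _] am; exact: fe.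
Qed.

(** Geometric decay in the degree makes the sums over bounded degree Cauchy; their limit is then
    shown to be the limit along all finite sets, so that [av_lim] is not its default value. *)
Lemma av_cvg_sum_monic (f : {poly F} -> E) (z : R) : 0 <= z < 1 ->
    (forall a, a \is monic -> av (f a) <= z ^+ (size a).-1) ->
  av_cvg av \oo (fun N => \sum_(v : 'rV[F]_N.+1 | rVpoly v \is monic) f (rVpoly v))
    (av_lim av totally (fun S : {fset {poly F}} => \sum_(a <- S | a \is monic) f a)).
Proof.
move=> /andP[z0 z1] fz.
have tail N a : a \is monic -> (N < size a)%N -> av (f a) <= z ^+ N.
  move=> am Na; apply: le_trans (fz _ am) _; apply: ler_wiXn2l; rewrite ?(ltW z1) //.
  by rewrite -ltnS prednK // (leq_trans _ Na).
have zN0 : (fun N => z ^+ N) @ \oo --> (0 : R).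
  by apply: cvg_expr; rewrite ger0_norm.
pose S N := \sum_(v : 'rV[F]_N | rVpoly v \is monic) f (rVpoly v).
have [l Sl] : exists l, av_cvg av \oo S l.
  apply: complete => e e0; have e20 : 0 < e / 2 by rewrite divr_gt0.
  have lt_e2 : e / 2 < e by rewrite ltr_pdivrMr // mulr_natr mulr2n ltrDl.
  have [N Nz] := cvg0_le e20 zN0.
  have H m n : (N <= m)%N -> (m <= n)%N -> av (S n - S m) < e.
    move=> Nm mn; apply: le_lt_trans lt_e2; apply: le_trans (Nz m Nm).
    rewrite /S -big_poly_below; apply: av_sum_monic_tail; first exact: exprn_ge0.
      exact: tail.
    by apply/fsubsetP => a; rewrite !in_poly_below => /leq_trans; apply.
  exists N => m n Nm Nn; have [mn|/ltnW nm] := leqP m n; last exact: H.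
  by rewrite -av_N opprB H.
have FT : ProperFilter (@totally {poly F}) := totally_filter.
rewrite (@av_lim_unique _ _ av _ totally FT _ l) //; first exact: (av_cvgS Sl).
apply/cvgrPdist_lt => e e0; have e20 : 0 < e / 2 by rewrite divr_gt0.
have lt_e2 : e / 2 < e by rewrite ltr_pdivrMr // mulr_natr mulr2n ltrDl.
have [N Nz] := cvg0_le e20 zN0.
move/av_cvg_nat : Sl => /(_ _ e20)[N' SN'].
(* [N] makes the contribution of higher degrees small, and [N'] brings the sum over bounded degree
   close to [l]. *)
exists (poly_below (maxn N N')) => // T /= NT.
rewrite sub0r normrN ger0_norm ?(av_ge0 avP) //; apply: le_lt_trans lt_e2.
rewrite -(subrK (S (maxn N N')) (\sum_(a <- T | _) f a)) -addrA; apply: av_le_max.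
  apply: le_trans (Nz (maxn N N') (leq_maxl _ _)).
  by apply: av_sum_monic_tail => //; [exact: exprn_ge0|exact: tail].
exact/ltW/SN'/leq_maxr.
Qed.

End MonicSums.
End AbsoluteValue.

(** * Passage to the limit *)

Section Main.
Variables (R : realType) (F : finFieldType) (E : fieldType) (av : E -> R).
Hypothesis avP : absolute_value av.
Hypothesis complete : forall u, av_cauchy av u -> exists l, av_cvg av \oo u l.
Variable iota : {rmorphism {poly F} -> E}.
Hypothesis iotaP : forall a, av (iota a) = poly_av R a.
Variable lam : E.
Hypothesis lamE : lam ^+ (#|F| - 1) = - iota 'X.

Local Notation q := #|F|.
Local Notation qR := (#|F|%:R : R).
Local Notation th := (iota 'X).
Local Notation c i := (th ^+ (q ^ i)).
Local Notation chiE := (map_poly (fun x : F => iota x%:P)).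

Lemma iota_injective : injective iota.
Proof.
move=> a b ab; apply/eqP; rewrite -subr_eq0; apply/negPn/negP => ab0.
have : av (iota (a - b)) = 0 by rewrite rmorphB ab subrr av_0.
rewrite iotaP /poly_av (negbTE ab0) => /eqP.
by rewrite expf_eq0 pnatr_eq0 gtn_eqF ?andbF // ltnW // finNzRing_gt1.
Qed.
Let iota_inj := iota_injective.

Let th0 : th != 0 := th_neq0 iota_inj.

Lemma qR_gt1 : 1 < qR. Proof. by rewrite ltr1n finNzRing_gt1. Qed.
Let q1 := qR_gt1.
Let q0 : 0 < qR := lt_trans ltr01 q1.

Lemma q_gt0 i : (0 < q ^ i)%N.
Proof. by rewrite expn_gt0 ltnW // finNzRing_gt1. Qed.

Lemma av_th : av th = qR.
Proof. by rewrite iotaP /poly_av polyX_eq0 size_polyX expr1. Qed.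

Lemma av_c i : av (c i) = qR ^+ (q ^ i).
Proof. by rewrite av_X ?av_th. Qed.

Lemma av_c_ge i : qR <= av (c i).
Proof. by rewrite av_c -{1}[qR]expr1 ler_weXn2l ?q_gt0 // ltW. Qed.

Lemma av_c_sub m n : (m < n)%N -> av (c n - c m) = av (c n).
Proof.
by move=> mn; rewrite av_subl // !av_c ltr_eXn2l // ltn_exp2l // finNzRing_gt1.
Qed.

Lemma av_c_subt t n : av t < qR -> av (c n - t) = av (c n).
Proof. by move=> tq; rewrite av_subl // (lt_le_trans tq) // av_c_ge. Qed.

Lemma av_c_th i : (0 < i)%N -> av (c i - th) = av (c i).
Proof. by move=> i0; rewrite -(av_c_sub i0) expn0 expr1. Qed.

Lemma av_period_part M : av (period_part iota lam M) = av (th * lam).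
Proof.
rewrite /period_part (avM avP) av_prod // big_nat big1 ?mulr1 // => i /andP[i0 _].
rewrite (period_factorE iota_inj) av_V // (avM avP) av_V // av_c_th // divff ?invr1 //.
by rewrite av_neq0 // expf_neq0.
Qed.

Lemma lam_neq0 : lam != 0.
Proof.
apply: contraTneq isT => l0; have := lamE; rewrite l0 expr0n.
have q2 := finNzRing_gt1 F.
by rewrite -[_ == 0%N]negbK -lt0n subn_gt0 q2 => /esym/eqP; rewrite oppr_eq0 (negbTE th0).
Qed.

Definition period := th * lam *
  av_lim av \oo (fun N => \prod_(1 <= i < N.+1) (1 - th ^ (1 - (q ^ i)%N%:Z))^-1).

Lemma period_cvg : av_cvg av \oo (period_part iota lam) period.
Proof.
apply: av_cvgM => //; first exact: av_cvg_cst.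
(* The factor of index [i.+1] differs from 1 by [th / (c i.+1 - th)], of absolute value
   [qR / qR ^+ (q ^ i.+1)]; the bound uses only [i <= q ^ i.+1]. *)
have [||i|l fl] := @av_cvg_prod _ _ _ avP complete
   (fun i => (1 - th ^ (1 - (q ^ i)%N%:Z))^-1) (fun i => qR * qR^-1 ^+ i).
- rewrite -[0](mulr0 qR); apply: cvgM; first exact: cvg_cst.
  by apply: cvg_expr; rewrite ger0_norm ?invr_ge0 ?ltW // invf_lt1.
- move=> i i0; rewrite (period_factorE iota_inj) av_V // (avM avP) av_V // av_c_th //.
  by rewrite divff ?invr1 // av_neq0 // expf_neq0.
- rewrite (period_factorE iota_inj) invf_div -[1](@divff _ (c i.+1 - th)).
    rewrite -mulrBl opprB addrC subrK (avM avP) av_V // av_c_th // av_th av_c.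
    rewrite ler_pM2l // -exprVn ler_wiXn2l ?invr_ge0 ?ltW ?invf_lt1 //.
    by rewrite (leq_trans (ltnW (ltnSn i))) // ltnW // ltn_expl // finNzRing_gt1.
  exact: c_sub_th_neq0.
by rewrite (av_lim_unique _ avP fl).
Qed.

Lemma av_period : av period = av (th * lam).
Proof.
apply: (av_cvg_av avP _ period_cvg av_period_part).
by rewrite av_gt0 // mulf_neq0 // lam_neq0.
Qed.

Lemma period_neq0 : period != 0.
Proof.
apply: contraTneq isT => p0; have := av_period.
rewrite p0 av_0 // => /esym/(av_eq0 avP)/eqP.
by rewrite mulf_eq0 (negbTE th0) (negbTE lam_neq0).
Qed.

Let rho n := av (th * lam) ^+ (q ^ n) / av (d_ iota n).

Lemma av_residue N n : av (residue iota lam N n) = rho n.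
Proof. by rewrite /residue (avM avP) av_V // av_X // av_period_part. Qed.

Lemma av_d n : av (d_ iota n) = (qR ^+ n) ^+ (q ^ n).
Proof.
rewrite (d_E iota) av_prod // big_nat (eq_bigr (fun=> qR ^+ (q ^ n))).
  by rewrite -big_nat prodr_const_nat subn0 -!exprM mulnC.
by move=> m /andP[_ mn]; rewrite av_c_sub // av_c.
Qed.

Lemma rho_ge0 n : 0 <= rho n.
Proof. by rewrite -(av_residue 0) (av_ge0 avP). Qed.

(** By [av_d], [rho n] is the [q ^ n]-th power of [av (th * lam) / qR ^+ n]. This base tends to 0,
    and once it is at most 1 it bounds its own powers. *)
Lemma rho_cvg0 : rho @ \oo --> 0.
Proof.
have B0 : (fun n => av (th * lam) * qR^-1 ^+ n) @ \oo --> 0.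
  rewrite -[0](mulr0 (av (th * lam))); apply: cvgM; first exact: cvg_cst.
  by apply: cvg_expr; rewrite ger0_norm ?invr_ge0 ?ltW // invf_lt1.
have [N NB] := cvg0_le ltr01 B0.
apply: (@squeeze_cvgr _ _ _ _ (fun=> 0) (fun n => av (th * lam) * qR^-1 ^+ n)) => //.
  exists N => // n /NB le1; rewrite rho_ge0 /rho av_d -expr_div_n -exprVn.
  rewrite -[leRHS]expr1; apply: ler_wiXn2l => //; last exact: q_gt0.
  by rewrite mulr_ge0 ?(av_ge0 avP) // exprn_ge0 // invr_ge0 ltW.
exact: cvg_cst.
Qed.

Lemma rho_bounded : exists2 b, 0 <= b & forall n, rho n <= b.
Proof.
have [N Nr] := cvg0_le ltr01 rho_cvg0.
have s0 : 0 <= \sum_(0 <= n < N) rho n by apply: sumr_ge0 => n _; exact: rho_ge0.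
exists (1 + \sum_(0 <= n < N) rho n) => [|n]; first by rewrite addr_ge0.
have [/Nr rn|nN] := leqP N n; first by rewrite (le_trans rn) // lerDl.
rewrite (bigD1_seq n) ?mem_index_iota ?iota_uniq //= addrCA lerDl addr_ge0 //.
by apply: sumr_ge0 => m _; exact: rho_ge0.
Qed.

Lemma residue_cvg n : av_cvg av \oo (fun N => residue iota lam N n)
  (period ^+ (q ^ n) / d_ iota n).
Proof.
apply: av_cvgM => //; last exact: av_cvg_cst.
by apply: av_cvgX => //; apply: (av_cvg_shift avP n period_cvg).
Qed.

(** The [i]-th coefficient of [s_Car_fps], with [e_Car] unfolded. *)
Definition s_coef i := av_lim av \oo (fun N => \sum_(0 <= n < N)
  (period / th ^+ i.+1) ^+ (q ^ n) / d_ iota n).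

Lemma omega_trunc_coef_cvg K i : (i < K)%N ->
  av_cvg av \oo (fun N => (omega_trunc iota lam N K)`_i) (s_coef i).
Proof.
move=> iK; pose y n := period ^+ (q ^ n) / d_ iota n * (c n)^-1 ^+ i.+1.
pose x N n := residue iota lam N n * (c n)^-1 ^+ i.+1.
have c1 n : av ((c n)^-1 ^+ i.+1) <= 1.
  rewrite av_X // av_V // exprn_ile1 ?invr_ge0 ?(av_ge0 avP) //.
  by rewrite invf_le1 ?(lt_le_trans q0 (av_c_ge n)) // (le_trans (ltW q1)) // av_c_ge.
have yr n : av (y n) <= rho n.
  rewrite /y !(avM avP) av_V // av_X // av_period -/(rho n).
  by rewrite -[leRHS]mulr1 ler_wpM2l // rho_ge0.
have [l yl] := av_cvg_series avP complete rho_cvg0 yr.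
have -> : s_coef i = l.
  apply: av_lim_unique => //.
  rewrite (_ : (fun N => _) = fun N => \sum_(0 <= n < N) y n) //.
  apply/funext => N; apply: eq_bigr => n _.
  (* The factor [(c n)^-1 ^+ i.+1] is the [q ^ n]-th power of [th ^- i.+1]. *)
  by rewrite /y expr_div_n mulrAC; congr (_ * _); rewrite exprVn -!exprM mulnC.
rewrite (_ : (fun N => _) = fun N => \sum_(0 <= n < N.+1) x N n).
  apply: (av_cvg_tannery avP rho_cvg0 _ yr _ yl) => [N n _|n].
    by rewrite /x (avM avP) av_residue -[leRHS]mulr1 ler_wpM2l // rho_ge0.
  by apply: av_cvgM => //; [exact: residue_cvg|exact: av_cvg_cst].
apply/funext => N; rewrite /omega_trunc coef_sum; apply: eq_bigr => n _.
by rewrite coefZ coef_poly iK.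
Qed.

(** * Convergence of the L-series and the limit identities *)

Definition L_coef k := av_lim av totally (fun S : {fset {poly F}} =>
  \sum_(a <- S | a \is monic) (chiE a)`_k * iota a ^- 1).

Definition L_val t := av_lim av totally (fun S : {fset {poly F}} =>
  \sum_(a <- S | a \is monic) (chiE a).[t] * iota a ^- 1).

Definition L_part N := \sum_(v : 'rV[F]_N.+1 | rVpoly v \is monic)
      (iota (rVpoly v))^-1 *: chiE (rVpoly v).

Lemma av_chi_coef a k : av (chiE a)`_k <= 1.
Proof.
rewrite -[chiE]/(map_poly (iota \o polyC)) coef_map /= iotaP /poly_av polyC_eq0.
by case: eqP => // /eqP x0; rewrite size_polyC x0 expr0.
Qed.

Lemma av_iota_monic a : a \is monic -> av (iota a) = qR ^+ (size a).-1.
Proof. by move=> /monic_neq0 a0; rewrite iotaP /poly_av (negbTE a0). Qed.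

Lemma L_coef_cvg k : av_cvg av \oo (fun N => (L_part N)`_k) (L_coef k).
Proof.
rewrite (_ : (fun N => _) = fun N => \sum_(v : 'rV[F]_N.+1 | rVpoly v \is monic)
   (chiE (rVpoly v))`_k * iota (rVpoly v) ^- 1); last first.
  apply/funext => N; rewrite /L_part coef_sum; apply: eq_bigr => v _.
  by rewrite coefZ mulrC.
apply: (@av_cvg_sum_monic _ _ _ avP complete F
  (fun a => (chiE a)`_k * iota a ^- 1) qR^-1).
  by rewrite invr_ge0 ltW //= invf_lt1.
move=> a am; rewrite (avM avP) expr1 av_V // av_iota_monic // exprVn.
by rewrite -[leRHS]mul1r ler_wpM2r ?av_chi_coef // invr_ge0 exprn_ge0 // ltW.
Qed.

Lemma L_val_cvg t : av t < qR -> av_cvg av \oo (fun N => (L_part N).[t]) (L_val t).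
Proof.
move=> tq.
rewrite (_ : (fun N => _) = fun N => \sum_(v : 'rV[F]_N.+1 | rVpoly v \is monic)
   (chiE (rVpoly v)).[t] * iota (rVpoly v) ^- 1); last first.
  apply/funext => N; rewrite /L_part horner_sum; apply: eq_bigr => v _.
  by rewrite hornerZ mulrC.
(* With coefficients of absolute value at most 1, [a(t)] is bounded by [b] to the degree of [a], and
   [b / qR < 1]. *)
pose b := Num.max 1 (av t).
have b1 : 1 <= b by rewrite le_max lexx.
have b0 : 0 <= b := le_trans ler01 b1.
apply: (@av_cvg_sum_monic _ _ _ avP complete F
  (fun a => (chiE a).[t] * iota a ^- 1) (b / qR)).
  apply/andP; split; first by rewrite divr_ge0 // ltW.
  by rewrite ltr_pdivrMr // mul1r gt_max q1.
move=> a am; rewrite (avM avP) expr1 av_V // av_iota_monic // expr_div_n.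
apply: ler_wpM2r; first by rewrite invr_ge0 exprn_ge0 // ltW.
rewrite horner_coef (size_map_poly (iota \o polyC)).
apply: av_sum_le => // [|i _ _]; first exact: exprn_ge0.
rewrite (avM avP) -[leRHS]mul1r ler_pM ?(av_ge0 avP) ?av_chi_coef // av_X //.
rewrite (@le_trans _ _ (b ^+ i)) //.
  by rewrite lerXn2r ?nnegrE ?(av_ge0 avP) // le_max lexx orbT.
by rewrite ler_weXn2l // -ltnS prednK // (leq_ltn_trans _ (ltn_ord i)).
Qed.

(** Coefficient [k] of [omega_identity] with [K = k.+1], as [N] grows: the error term is divisible
    by ['X^(k.+1)] and does not contribute. *)
Lemma conv_s_L k : \sum_(i < k.+1)
   (\sum_(j < i.+1) ('X - th%:P)`_j * s_coef (i - j)) * L_coef (k - i) =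
  - period * (k == 0%N)%:R.
Proof.
apply: (@av_cvg_unique _ _ _ avP _ \oo _
  (fun N => ((('X - th%:P) * omega_trunc iota lam N k.+1) * L_part N)`_k)).
  under eq_fun do rewrite coefM.
  apply: av_cvg_sum => // i _; apply: av_cvgM => //; last exact: L_coef_cvg.
  under eq_fun do rewrite coefM.
  apply: av_cvg_sum => // j _; apply: av_cvgM => //; first exact: av_cvg_cst.
  by apply: omega_trunc_coef_cvg; rewrite ltnS (leq_trans (leq_subr _ _)) // -ltnS.
under eq_fun do
  rewrite (omega_identity iota_inj lamE) coefD coefN coefC coefXnM ltnSn addr0.
rewrite mulNr; apply: av_cvgN => //; case: eqP => _.
  by rewrite mulr1; exact: period_cvg.
by rewrite mulr0; exact: av_cvg_cst.
Qed.

(** The bound is uniform in [N], so it survives the limit in [N] at fixed [K]. *)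
Lemma omega_rem_bound : exists2 b, 0 <= b &
  forall N K t, av t < qR -> av (omega_rem iota lam N K).[t] <= b / qR ^+ K.
Proof.
have [b b0 rb] := rho_bounded; exists b => // N K t tq.
rewrite /omega_rem horner_sum; apply: av_sum_le => [||n] //.
  by rewrite divr_ge0 // exprn_ge0 // ltW.
rewrite mem_index_iota => /andP[_ nN] _.
rewrite hornerZ horner_prod (avM avP) (avM avP) (avM avP) av_residue (av_V avP).
rewrite !(av_prod avP).
have -> : \prod_(1 <= i < N.+1) av (c i - th) = \prod_(1 <= i < N.+1) av (c i).
  by apply: eq_big_nat => i /andP[i0 _]; exact: av_c_th.
have -> : \prod_(0 <= m < N.+1 | m != n) av ((c m)%:P - 'X).[t] =
    \prod_(0 <= m < N.+1 | m != n) av (c m).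
  by apply: eq_bigr => m _; rewrite !hornerE av_c_subt.
set P := \prod_(1 <= i < N.+1) _; set Q := \prod_(0 <= m < N.+1 | _) _.
have cn0 : 0 < av (c n) by apply: lt_le_trans (av_c_ge n).
have P0 : 0 < P by apply: prodr_gt0 => i _; apply: lt_le_trans (av_c_ge i).
have Q0 : 0 <= Q by apply: prodr_ge0 => i _; apply: (av_ge0 avP).
(* [P] omits the node [0] and [Q] the node [n], so [Q / P] is [av (c 0) / av (c n)], which is at
   most 1. *)
have PQ : av (c n) * Q = av (c 0) * P.
  by rewrite /Q /P -[RHS]big_ltn // [RHS](bigD1_seq n) ?mem_index_iota ?iota_uniq.
rewrite -2!mulrA; apply: ler_pM => //; first exact: rho_ge0.
  by rewrite !mulr_ge0 ?invr_ge0 ?(av_ge0 avP) // ltW.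
rewrite -[leRHS]mulr1; apply: ler_pM; rewrite ?(av_ge0 avP) //.
- by rewrite mulr_ge0 // invr_ge0 ltW.
- rewrite av_X // av_V // exprVn lef_pV2 ?posrE ?exprn_gt0 //.
  by apply: lerXn2r; rewrite ?nnegrE ?av_c_ge // ltW.
rewrite mulrC ler_pdivrMr // mul1r -(ler_pM2l cn0) PQ expr1 av_th.
by apply: ler_wpM2r; [exact: ltW | exact: av_c_ge].
Qed.

(** First [N] tends to infinity at fixed [K], leaving an error of at most [b * (av t / qR) ^+ K];
    then [K] does. *)
Lemma s_val_cvg t : av t < qR -> L_val t != 0 /\
  av_cvg av \oo (fun K => \sum_(0 <= i < K) s_coef i * t ^+ i)
    (- period / ((t - th) * L_val t)).
Proof.
move=> tq; have [b b0 rb] := omega_rem_bound.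
have tth : t - th != 0.
  by apply: contraTneq tq => /subr0_eq ->; rewrite av_th ltxx.
pose S K := \sum_(0 <= i < K) s_coef i * t ^+ i.
have W K : av_cvg av \oo (fun N => (omega_trunc iota lam N K).[t]) (S K).
  rewrite (_ : (fun N => _) =
      fun N => \sum_(0 <= i < K) (omega_trunc iota lam N K)`_i * t ^+ i).
    rewrite /S big_nat; under eq_fun do rewrite big_nat.
    apply: av_cvg_sum => // i /andP[_ iK]; apply: av_cvgM => //; last exact: av_cvg_cst.
    exact: omega_trunc_coef_cvg.
  apply/funext => N; rewrite big_mkord (@horner_coef_wide _ K) //.
  rewrite /omega_trunc; apply: (leq_trans (size_sum _ _ _)).
  apply/bigmax_leqP_seq => n _ _; apply: leq_trans (size_scale_leq _ _) _.
  exact: size_poly.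
have SK : av_cvg av \oo (fun K => (t - th) * L_val t * S K) (- period).
  apply: (@av_cvg_squeeze _ _ _ avP _ _ _ _ _ (fun K => b * (av t / qR) ^+ K)).
    apply: nearW => K; rewrite opprK.
    apply: (@av_cvg_le _ _ _ avP _ \oo _ (fun N => (t - th) * (L_part N).[t] *
        (omega_trunc iota lam N K).[t] + period_part iota lam N)).
      apply: av_cvgD => //; last exact: period_cvg.
      apply: av_cvgM => //; apply: av_cvgM => //; first exact: av_cvg_cst.
      exact: L_val_cvg.
    move=> N; have := congr1 (horner^~ t) (omega_identity iota_inj lamE N K).
    rewrite /= -/(L_part N) !hornerE [_ * _ * (L_part N).[t]]mulrAC => ->.
    rewrite addrAC addNr add0r (avM avP) av_X // expr_div_n [b * _]mulrCA.
    by apply: ler_wpM2l; [rewrite exprn_ge0 ?(av_ge0 avP) | exact: rb].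
  rewrite -[0](mulr0 b); apply: cvgM; first exact: cvg_cst.
  apply: cvg_expr; rewrite ger0_norm ?divr_ge0 ?(av_ge0 avP) ?ltW //.
  by rewrite ltr_pdivrMr // mul1r.
(* Otherwise the constant sequence 0 would converge to [- period], which is nonzero. *)
have L0 : L_val t != 0.
  apply: contraTneq isT => L0; move: SK; rewrite L0 mulr0.
  under eq_fun do rewrite mul0r.
  move=> /(av_cvg_unique avP (av_cvg_cst avP 0))/esym/eqP.
  by rewrite oppr_eq0 (negbTE period_neq0).
split => //; have T0 : (t - th) * L_val t != 0 by rewrite mulf_neq0.
rewrite mulrC (_ : (fun K => _) =
    fun K => ((t - th) * L_val t)^-1 * ((t - th) * L_val t * S K)).
  by apply: av_cvgM => //; exact: av_cvg_cst.
by apply/funext => K; rewrite mulKf.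
Qed.
End Main.

(** * Division of formal power series *)

Section Fps.
Variable E : fieldType.
Implicit Types (f g h : fps E) (a : E).

Lemma fps_mulC_poly a g n : fps_mul (fps_of_poly a%:P) g n = a * g n.
Proof.
rewrite /fps_mul big_ord_recl subn0 big1 ?addr0 /fps_of_poly ?coefC // => i _.
by rewrite coefC mul0r.
Qed.

Lemma fps_mul_inj f g h : f 0%N != 0 -> fps_mul f g =1 fps_mul f h -> g =1 h.
Proof.
move=> f0 fgh; elim/ltn_ind => n IH; have := fgh n.
rewrite /fps_mul !big_ord_recl !subn0 => /eqP; rewrite -subr_eq -addrA.
rewrite [X in _ + X](_ : _ = 0) ?addr0 => [/eqP/(mulfI f0)//|].
rewrite -sumrB big1 // => i _; rewrite IH ?subrr //.
by rewrite lift0 ltn_subrL (leq_ltn_trans _ (ltn_ord i)).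
Qed.

(** Multiplying [f] by either side gives the constant series [a], and [f] can be cancelled since its
    constant term is nonzero. *)
Lemma fps_divP a f h : f 0%N != 0 -> (forall n, fps_mul f h n = a * (n == 0%N)%:R) ->
  h =1 fps_div (fps_of_poly a%:P) f.
Proof.
move=> f0 fh; apply: (fps_mul_inj f0) => n; rewrite fh.
have := fps_mulfV f0 n; rewrite /fps_of_poly coef1 => <-.
rewrite /fps_mul mulr_sumr; apply: eq_bigr => i _.
by rewrite /fps_div fps_mulC_poly mulrCA.
Qed.

End Fps.

Theorem theorem1 (R : realType) (F : finFieldType) (X : Cinf_tower R F)
    (lam : Cinf X) (hlam : lam ^+ (#|F| - 1) = - theta X) :
  let pi_ := carlitz_period lam in
  let D := fps_mul (fps_of_poly ('X - (theta X)%:P)) (s_Car_fps pi_) in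
  (D 0%N != 0 /\ L_fps X 1 =1 fps_div (fps_of_poly (- pi_)%:P) D) /\
  (forall t : Cinf X, Cinf_av X t < #|F|%:R ->
     (t - theta X) * s_Car_fun pi_ t != 0 /\
     L_fun 1 t = - (pi_ / ((t - theta X) * s_Car_fun pi_ t))).
Proof.
move=> pi_ D.
have [avP avE _ complete] := Cinf_completion X.
pose iota : {rmorphism {poly F} -> Cinf X} :=
  (Kbar_to_Cinf X \o (Kinf_to_Kbar X \o (K_to_Kinf X \o @FracField.tofrac {poly F}))).
have iotaP a : Cinf_av X (iota a) = poly_av R a.
  rewrite /= avE Kbar_av_ext (completion_isom (Kinf_completion X)).
  (* All embeddings are isometric, so it suffices to compute in the fraction field, with [a] written
     as [a / 1]. *)
  have := frac_avE R a (oner_neq0 {poly F}); rewrite rmorph1 divr1 => ->.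
  by rewrite {2}/poly_av oner_eq0 size_poly1 expr0 divr1.
have pi0 : pi_ != 0 := period_neq0 avP complete iotaP hlam.
(* The definitions over the tower unfold to those over [iota], so this holds by conversion. *)
have conv k : fps_mul D (L_fps X 1) k = - pi_ * (k == 0%N)%:R :=
  conv_s_L avP complete iotaP hlam k.
split.
  have D0 : D 0%N != 0.
    (* The constant terms of [D] and of the L-series multiply to [- pi_], which is nonzero. *)
    have := conv 0%N; rewrite {1}/fps_mul big_ord_recl big_ord0 addr0 mulr1 => DL.
    by apply: contraTneq pi0 => D0; rewrite negbK -oppr_eq0 -DL D0 mul0r.
  by split=> //; exact: fps_divP.
move=> t tq; have [L0 sL] := s_val_cvg avP complete iotaP hlam tq.
have -> : s_Car_fun pi_ t = - pi_ / ((t - theta X) * L_fun 1 t).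
  exact: av_lim_unique avP sL.
have tth : t - theta X != 0.
  apply: contraTneq tq => /subr0_eq ->; rewrite -/(theta X).
  by rewrite -[theta X]/(iota 'X) iotaP /poly_av polyX_eq0 size_polyX ltxx.
have -> : (t - theta X) * (- pi_ / ((t - theta X) * L_fun 1 t)) = - pi_ / L_fun 1 t.
  by rewrite invfM mulrCA mulVKf.
split; first by rewrite mulf_neq0 ?oppr_eq0 ?invr_eq0.
by rewrite invf_div mulrA invrN mulrN opprK mulrAC divff ?mul1r.
Qed.
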